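(* For any twin-free graph $G$ of order $n$ and any integer $m\ge3$, $$\gamma^{\rm ID}(G\Box P_m) \le \min\left\{m\,\gamma^{\rm ID}(G),\; m\,\gamma(G) + \left\lceil \frac{m}{3}\right\rceil(n - \gamma(G))\right\}.$$
   Context: All graphs are finite, simple and undirected. $N[x]$ denotes the closed neighborhood of a vertex $x$; a graph is twin-free if no two distinct vertices have the same closed neighborhood. A set $D\subseteq V(F)$ is a dominating set of $F$ if $N[x]\cap D\neq\emptyset$ for every vertex $x$; $\gamma(F)$ is the minimum cardinality of a dominating set. An identifying code (ID code) of $F$ is a dominating set $C$ such that $N[x]\cap C\neq N[y]\cap C$ for all distinct vertices $x,y$; $\gamma^{\rm ID}(F)$ is the minimum cardinality of an ID code of $F$. $P_m$ is the path on $m$ vertices and $\Box$ denotes the Cartesian product of graphs. *)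

(* Defs.v *)
From mathcomp Require Import all_boot.

Set Implicit Arguments.
Unset Strict Implicit.
Unset Printing Implicit Defensive.

Record sgraph := SGraph {
  vertex :> finType;
  adj : rel vertex;
  adj_sym : symmetric adj;
  adj_irrefl : irreflexive adj }.

Definition closed_nbhd (G : sgraph) (x : G) : {set G} :=
  [set y | (y == x) || adj x y].

Definition twin_free (G : sgraph) : Prop :=
  forall x y : G, closed_nbhd x = closed_nbhd y -> x = y.

Definition dominating (G : sgraph) (D : {set G}) : bool :=
  [forall x : G, closed_nbhd x :&: D != set0].

Definition id_code (G : sgraph) (C : {set G}) : bool :=
  dominating C &&
  [forall x : G, forall y : G,
    (x != y) ==> (closed_nbhd x :&: C != closed_nbhd y :&: C)].

Definition domination_number (G : sgraph) : nat :=
  #|[arg min_(D < [set: G] | dominating D) #|D|]|.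

(* The default [set: G] of the arg min is an ID code exactly when G is
   twin-free; when G has twins there is no ID code and the value is #|G|. *)
Definition id_number (G : sgraph) : nat :=
  #|[arg min_(C < [set: G] | id_code C) #|C|]|.

Definition path_adj (m : nat) : rel 'I_m :=
  fun i j => (i.+1 == j :> nat) || (j.+1 == i :> nat).

Lemma path_adj_sym (m : nat) : symmetric (@path_adj m).
Proof. by move=> i j; rewrite /path_adj orbC. Qed.

Lemma path_adj_irrefl (m : nat) : irreflexive (@path_adj m).
Proof. by move=> i; rewrite /path_adj orbb gtn_eqF. Qed.

Definition path_graph (m : nat) : sgraph :=
  SGraph (@path_adj_sym m) (@path_adj_irrefl m).

Definition cart_adj (G H : sgraph) : rel (G * H) :=
  fun u v => ((u.1 == v.1) && adj u.2 v.2) || ((u.2 == v.2) && adj u.1 v.1).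

Lemma cart_adj_sym (G H : sgraph) : symmetric (@cart_adj G H).
Proof.
by move=> u v; rewrite /cart_adj (eq_sym u.1) (eq_sym u.2) !(adj_sym u.1, adj_sym u.2).
Qed.

Lemma cart_adj_irrefl (G H : sgraph) : irreflexive (@cart_adj G H).
Proof. by move=> u; rewrite /cart_adj !adj_irrefl !andbF. Qed.

Definition cart_prod (G H : sgraph) : sgraph :=
  SGraph (@cart_adj_sym G H) (@cart_adj_irrefl G H).

Notation "G □ H" := (cart_prod G H) (at level 40, left associativity).

(* ⌈m / d⌉ for d > 0. *)
Definition ceil_div (m d : nat) : nat := (m + d.-1) %/ d.

Lemma dominating_setT (G : sgraph) : dominating [set: G].
Proof.
by apply/forallP => x; apply/set0Pn; exists x; rewrite !inE eqxx.
Qed.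

Lemma id_code_setT (G : sgraph) : twin_free G -> id_code [set: G].
Proof.
move=> tfG; rewrite /id_code dominating_setT /=.
apply/forallP => x; apply/forallP => y; apply/implyP; rewrite !setIT.
by apply: contraNneq => /tfG ->.
Qed.

(* Main.v *)
(* For twin-free G and H, consider a code E of G □ H containing D × V(H) with D
   dominating in G.  If (x,i) and (y,j) with i != j have the same trace on E,
   then a vertex of D dominating x, taken in layer i, is in the closed
   neighborhood of (y,j), hence equals y; so y, and likewise x, lies in D, and
   then (x,i) itself forces x = y.  Since {x} × V(H) is contained in E, the
   twin-freeness of H gives i = j.  So it remains to separate vertices of the
   same layer; this holds when D is an ID code of G and E = D × V(H), and when
   E also contains V(G) × S with S dominating in H: a layer in S is separated
   by the twin-freeness of G, and any other layer has a neighboring layer in S. *)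

Require Import Defs.
From mathcomp Require Import all_boot zify.

Lemma closed_nbhd_refl (G : sgraph) (x : G) : x \in closed_nbhd x.
Proof. by rewrite inE eqxx. Qed.

Lemma dominatingP (G : sgraph) (D : {set G}) :
  reflect (forall x, exists2 d, d \in D & d \in closed_nbhd x) (dominating D).
Proof.
apply: (iffP forallP) => domD x; first by
  have /set0Pn[d /setIP[dx dD]] := domD x; exists d.
by have [d dD dx] := domD x; apply/set0Pn; exists d; apply/setIP.
Qed.

(** Traces are compared pointwise on [C], so that each code vertex becomes a test to instantiate. *)
Lemma id_codeP (G : sgraph) (C : {set G}) :
  reflect (dominating C /\
           forall x y, {in C, closed_nbhd x =i closed_nbhd y} -> x = y)
          (id_code C).
Proof.
apply: (iffP andP) => -[domC sepC]; split=> //.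
  move=> x y eqC; apply/eqP/negPn/negP => neq_xy.
  move/forallP/(_ x)/forallP/(_ y): sepC; rewrite neq_xy => /eqP; apply.
  apply/setP => z; rewrite !in_setI.
  by case zC: (z \in C); rewrite ?andbF // (eqC z zC).
apply/forallP => x; apply/forallP => y; apply/implyP; apply: contraNneq => eqC.
apply/eqP/sepC => z zC.
by have /setP/(_ z) := eqC; rewrite !in_setI zC !andbT.
Qed.

Lemma id_code_twin_free (G : sgraph) (C : {set G}) : id_code C -> twin_free G.
Proof. by case/id_codeP => _ sepC x y eqN; apply: sepC => z _; rewrite eqN. Qed.

Lemma id_number_le (G : sgraph) (C : {set G}) : id_code C -> id_number G <= #|C|.
Proof.
move=> idC; rewrite /id_number; case: arg_minnP => [|E _]; last exact.
(* The given code [C] forces twin-freeness, so the default [[set: G]] of the arg min is itself an ID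
   code. *)
exact/id_code_setT/(id_code_twin_free _ _ idC).
Qed.

Lemma id_numberP (G : sgraph) :
  twin_free G -> exists2 C : {set G}, id_code C & #|C| = id_number G.
Proof.
move=> tfG; rewrite /id_number; case: arg_minnP => [|C idC _]; last by exists C.
exact: id_code_setT.
Qed.

Lemma domination_number_le (G : sgraph) (D : {set G}) :
  dominating D -> domination_number G <= #|D|.
Proof.
move=> domD; rewrite /domination_number.
by case: arg_minnP => [|E _]; [exact: dominating_setT | exact].
Qed.

Lemma domination_numberP (G : sgraph) :
  exists2 D : {set G}, dominating D & #|D| = domination_number G.
Proof.
rewrite /domination_number; case: arg_minnP => [|D domD _]; last by exists D.
exact: dominating_setT.
Qed.

Lemma in_closed_nbhd_cart (G H : sgraph) (x y : G) (i j : H) :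
  ((y, j) \in closed_nbhd ((x, i) : G □ H)) =
  (y == x) && (j \in closed_nbhd i) || (j == i) && (y \in closed_nbhd x).
Proof.
rewrite !inE /= /cart_adj /= xpair_eqE (eq_sym x) (eq_sym i).
by case: (y == x); case: (j == i); rewrite ?orbF.
Qed.

Lemma in_closed_nbhd_layer (G H : sgraph) (x y : G) (i : H) :
  ((y, i) \in closed_nbhd ((x, i) : G □ H)) = (y \in closed_nbhd x).
Proof.
rewrite in_closed_nbhd_cart eqxx closed_nbhd_refl andbT.
by case: eqP => [->|//]; rewrite closed_nbhd_refl.
Qed.

Lemma in_closed_nbhd_fiber (G H : sgraph) (x : G) (i j : H) :
  ((x, j) \in closed_nbhd ((x, i) : G □ H)) = (j \in closed_nbhd i).
Proof.
rewrite in_closed_nbhd_cart eqxx closed_nbhd_refl andbT.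
by case: eqP => [->|_]; rewrite ?closed_nbhd_refl ?orbF.
Qed.

(** Common core of both bounds: each code then only has to separate vertices within one layer. *)
Lemma id_code_cart (G H : sgraph) (D : {set G}) (E : {set G □ H}) :
  twin_free H -> dominating D ->
  (forall x i, x \in D -> (x, i) \in E) ->
  (forall x y i, {in E, closed_nbhd ((x, i) : G □ H) =i
                        closed_nbhd ((y, i) : G □ H)} -> x = y) ->
  id_code E.
Proof.
move=> tfH /dominatingP domD sDE sepE; apply/id_codeP; split.
  apply/dominatingP => -[x i]; have [d dD dx] := domD x.
  by exists (d, i); [exact: sDE | rewrite in_closed_nbhd_cart eqxx dx orbT].
have inD x y i j : i != j ->
    {in E, closed_nbhd ((x, i) : G □ H) =i closed_nbhd ((y, j) : G □ H)} ->
    y \in D.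
  move=> neq_ij eqE; have [d dD dx] := domD x.
  have := eqE _ (sDE d i dD).
  rewrite !in_closed_nbhd_cart eqxx dx orbT (negPf neq_ij) orbF.
  by move=> /esym/andP[/eqP <-].
move=> [x i] [y j] eqE.
have [eq_ij|neq_ij] := eqVneq i j.
  by rewrite -eq_ij in eqE *; rewrite (sepE _ _ _ eqE).
have xD : x \in D.
  by apply: (inD y x j i); [rewrite eq_sym | move=> z zE; rewrite eqE].
have eq_xy : x = y.
  have := eqE _ (sDE x i xD); rewrite closed_nbhd_refl in_closed_nbhd_cart.
  by rewrite (negPf neq_ij) orbF => /esym/andP[/eqP].
rewrite -eq_xy in eqE *; congr (_, _); apply: tfH; apply/setP => k.
by have := eqE _ (sDE x k xD); rewrite !in_closed_nbhd_fiber.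
Qed.

Lemma id_number_cart_le_id (G H : sgraph) :
  twin_free G -> twin_free H -> id_number (G □ H) <= #|H| * id_number G.
Proof.
move=> tfG tfH; have [C idC <-] := id_numberP G tfG.
have [domC sepC] := id_codeP _ _ idC.
rewrite mulnC -(cardsT H) -cardsX; apply: id_number_le.
apply: (id_code_cart _ _ C) => // [x i xC|x y i eqE].
  by rewrite in_setX xC in_setT.
apply: sepC => z zC; have /eqE : (z, i) \in setX C setT by rewrite in_setX zC in_setT.
by rewrite !in_closed_nbhd_layer.
Qed.

Lemma id_number_cart_le_dom (G H : sgraph) :
  twin_free G -> twin_free H ->
  id_number (G □ H) <= #|H| * domination_number G
                       + domination_number H * (#|G| - domination_number G).
Proof.
move=> tfG tfH; have [D domD <-] := domination_numberP G.
have [S domS <-] := domination_numberP H.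
(* This is the union of D × V(H) and V(G) × S, with the overlap D × S removed from the second part
   so that the cardinalities add up to the bound. *)
pose E : {set G □ H} := setX D setT :|: setX (~: D) S.
have inE_S z k : k \in S -> (z, k) \in E.
  by move=> kS; rewrite !inE /= kS; case: (z \in D).
suff /id_number_le/leq_trans : id_code E.
  apply; apply: leq_trans (leq_card_setU _ _) _.
  by rewrite !cardsX cardsT (cardsCs (~: D)) setCK mulnC [#|S| * _]mulnC.
apply: (id_code_cart _ _ D) => // [x i xD|x y i eqE]; first by rewrite !inE /= xD.
have [k kS ki] := dominatingP _ _ domS i.
have [eq_ki|neq_ki] := eqVneq k i.
  apply/tfG/setP => z; rewrite eq_ki in kS.
  by have := eqE _ (inE_S z i kS); rewrite !in_closed_nbhd_layer.
(* Layer [k] is adjacent to layer [i] and lies in [E]; the only neighbor of [(y, i)] in it is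
   [(y, k)], so testing [(x, k)] gives x = y. *)
have := eqE _ (inE_S x k kS).
rewrite in_closed_nbhd_fiber ki in_closed_nbhd_cart (negPf neq_ki) orbF.
by move=> /esym/andP[/eqP].
Qed.

Lemma in_closed_nbhd_path (m : nat) (i j : path_graph m) :
  (j \in closed_nbhd i) = ((i : 'I_m) <= (j : 'I_m).+1) && ((j : 'I_m) <= (i : 'I_m).+1).
Proof. by rewrite inE /= /path_adj -val_eqE /=; lia. Qed.

Lemma path_twin_free (m : nat) : 3 <= m -> twin_free (path_graph m).
Proof.
move=> hm i j eqN.
have eqn k : k < m -> (i <= k.+1) && (k <= i.+1) = (j <= k.+1) && (k <= j.+1).
  by move=> km; move/setP/(_ (Ordinal km)): eqN; rewrite !in_closed_nbhd_path.
apply: val_inj => /=; have := ltn_ord i; have := ltn_ord j.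
(* If i < j, the vertex [i.-1] (truncated at 0) separates them, except for i = 0 and j = 1, which
   are separated by vertex 2; it exists since m is at least 3. *)
move: (eqn i.-1) (eqn i.+1) (eqn j.-1) (eqn j.+1) (eqn i.+2) (eqn j.+2).
by move: {eqN eqn} (val i) (val j) => /= a b; lia.
Qed.

Lemma domination_number_path_le (m : nat) :
  domination_number (path_graph m) <= ceil_div m 3.
Proof.
case: m => [|m].
  by apply: leq_trans (max_card _) _; rewrite /= card_ord.
(* Cut the path into blocks of three and take the centers 3k + 1. The minimum with the last vertex
   [m] handles a final block of a single vertex. *)
pose f (k : 'I_(ceil_div m.+1 3)) : path_graph m.+1 := inord (minn (3 * k).+1 m).
rewrite -[leqRHS]card_ord; apply: leq_trans (leq_imset_card f _).
apply: domination_number_le; apply/dominatingP => i.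
have k_lt : (i : 'I__) %/ 3 < ceil_div m.+1 3.
  by have := ltn_ord i; rewrite /ceil_div; lia.
exists (f (Ordinal k_lt)); first exact: imset_f.
rewrite in_closed_nbhd_path /f inordK /=; last by lia.
by have := ltn_ord i; lia.
Qed.

Theorem theorem17 (G : sgraph) (n m : nat) (hG : twin_free G)
    (hn : #|G| = n) (hm : 3 <= m) :
  id_number (G □ path_graph m) <=
    minn (m * id_number G)
         (m * domination_number G
            + ceil_div m 3 * (n - domination_number G)).
Proof.
have tfP := path_twin_free m hm.
have cardP : #|path_graph m| = m := card_ord m.
rewrite leq_min; apply/andP; split.
  by rewrite -{2}cardP; exact: id_number_cart_le_id.
rewrite -hn; apply: leq_trans (id_number_cart_le_dom _ _ hG tfP) _.
by rewrite cardP leq_add2l leq_mul2r domination_number_path_le orbT.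
Qed.
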